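(* Fix either version $B=X$ or $B=D$, and let $\mathcal I$ be an admissible order ideal in $\mathcal P$. Then the space $B[\mathcal P\setminus\mathcal I]=\bigcup_{\mathfrak f\in\mathcal P\setminus\mathcal I}B[\mathfrak f]$ is a strong deformation retract of $B[\mathbb I]\setminus B[\mathbb J]$.
   Context: $\mathfrak g$ is the Lie algebra of a compact Lie group with Euclidean inner product $Q$ satisfying $Q([X,Y],Z)=Q(X,[Y,Z])$; linear operators are symmetric if $Q(AX,Y)=Q(X,AY)$. For symmetric $A$ and $a\in\mathbb R$, $F_a$ is the span of eigenvectors with eigenvalue $\le a$; $A$ is filtering if $[F_a,F_b]\subseteq F_{a+b}$ for all $a,b$; $\mathfrak F_+$ is the set of filtering symmetric operators with nonnegative spectrum and trace $1$. $\mathfrak h\subsetneq\mathfrak g$ is a fixed subalgebra, $\mathcal A$ a compact group of automorphisms of $\mathfrak g$ preserving $\mathfrak h$ and $Q$. $\mathcal P$ is the set of all $\mathcal A$-invariant subalgebras $\mathfrak k$ with $\mathfrak h\subsetneq\mathfrak k\subseteq\mathfrak g$, viewed as a subset of the disjoint union of the Grassmannians of $\mathfrak g$. An order ideal is a subset $\mathcal I\subseteq\mathcal P$ such that $\mathfrak l\subseteq\mathfrak j$, $\mathfrak l\in\mathcal P$, $\mathfrak j\in\mathcal I$ imply $\mathfrak l\in\mathcal I$; it is admissible if $\mathfrak g\notin\mathcal I$ and both $\mathcal I$ and $\mathcal P\setminus\mathcal I$ are compact semialgebraic. For $\mathfrak k\in\mathcal P$, $\mathfrak k\ne\mathfrak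 g$: $\bar\chi^{\mathfrak k}=\frac{1}{\dim(\mathfrak g/\mathfrak k)}(1_{\mathfrak g}-1_{\mathfrak k})$ ($1_{\mathfrak k}$ the $Q$-orthogonal projection); $D[\mathfrak k]$ is the set of symmetric operators with nonnegative spectrum and trace $1$ commuting with all elements of $\mathcal A$, annihilating $\mathfrak k$ and commuting with $\mathrm{ad}(X)$, $X\in\mathfrak k$; $X[\mathfrak k]=D[\mathfrak k]\cap\mathfrak F_+$; $D[\mathfrak g]=X[\mathfrak g]=\emptyset$. A flag is $\varphi=(\mathfrak f_1,\dots,\mathfrak f_r)$, $r\ge1$, with $\mathfrak f_i\in\mathcal P$ and $\mathfrak f_1\supsetneq\dots\supsetneq\mathfrak f_r$, identified with its set of members, $\max\varphi=\mathfrak f_1$; $\Delta(\mathcal S)$ is the set of flags with all members in $\mathcal S$. For a flag $\chi$ not containing $\mathfrak g$, $/\chi/$ is the convex hull of $\{\bar\chi^{\mathfrak f}:\mathfrak f\in\chi\}$. Butterflies: $B[(\mathfrak f)]=B[\mathfrak f]$; if $r>1$, $\mathfrak f_1=\mathfrak g$: $B[\varphi]=/(\mathfrak f_2,\dots,\mathfrak f_r)/$; if $r>1$, $\mathfrak f_1\ne\mathfrak g$: $B[\varphi]$ is the union of closed segments joining points of $B[\mathfrak f_1]$ to points of $/(\mathfrak f_2,\dots,\mathfrak f_r)/$. Set $\mathbb I=\{\varphi\in\Delta(\mathcal P)\setminus\Delta(\mathcal I):\varphi\setminus\{\max\varphi\}\subseteq\mathcal I\}$, $\mathbb J=\{\varphi\in\mathbb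 I:\mathfrak g\in\varphi\}$, and for a set $\Phi$ of flags $B[\Phi]=\bigcup_{\varphi\in\Phi}B[\varphi]$. *)

(* Defs.v *)
From HB Require Import structures.
From mathcomp Require Import all_boot all_order all_algebra.
From mathcomp Require Import all_classical all_reals all_analysis.
Import numFieldNormedType.Exports.
Set Implicit Arguments.
Unset Strict Implicit.
Unset Printing Implicit Defensive.
Import Order.TTheory GRing.Theory Num.Theory.
Local Open Scope classical_set_scope.
Local Open Scope ring_scope.

(* The Lie algebra g is modelled as 'rV[R]_n, with Q the standard dot product;
   linear operators act on the right:  X |-> X *m M.
   Subspaces k of g are represented by their Q-orthogonal projection 1_k
   (a symmetric idempotent matrix), which is the standard embedding of the
   disjoint union of the Grassmannians of g into the matrices. *)

Section Defs.
Variables (R : realType) (n : nat).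
Implicit Types (x y : 'rV[R]_n) (M p q : 'M[R]_n).
Implicit Types (br : 'rV[R]_n -> 'rV[R]_n -> 'rV[R]_n) (A : set 'M[R]_n).

Definition dot x y : R := \sum_(i < n) x 0 i * y 0 i.

Definition lie_bracket (br : 'rV[R]_n -> 'rV[R]_n -> 'rV[R]_n) : Prop :=
  [/\ forall (a : R) x y z, br (a *: x + y) z = a *: br x z + br y z,
      forall x y, br x y = - br y x,
      forall x y z, br x (br y z) + br y (br z x) + br z (br x y) = 0
    & forall x y z, dot (br x y) z = dot x (br y z)].

Definition symmetric_op M : Prop := forall x y, dot (x *m M) y = dot x (y *m M).

(* Q-orthogonal projections (= points of the Grassmannians) *)
Definition is_proj p : Prop := symmetric_op p /\ p *m p = p.
Definition inspace p x : Prop := x *m p = x.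
Definition subsp p q : Prop := forall x, inspace p x -> inspace q x.
Definition strict_subsp p q : Prop := subsp p q /\ p <> q.

Definition subalg (br : 'rV[R]_n -> 'rV[R]_n -> 'rV[R]_n) p : Prop :=
  is_proj p /\ forall x y, inspace p x -> inspace p y -> inspace p (br x y).

Definition aut_gQh (br : 'rV[R]_n -> 'rV[R]_n -> 'rV[R]_n) hp (a : 'M[R]_n) : Prop :=
  [/\ a \in unitmx,
      forall x y, br (x *m a) (y *m a) = br x y *m a,
      forall x y, dot (x *m a) (y *m a) = dot x y
    & forall x, inspace hp x -> inspace hp (x *m a)].

Definition compact_aut_group br hp (A : set 'M[R]_n) : Prop :=
  [/\ A 1%:M,
      forall a b, A a -> A b -> A (a *m b),
      forall a, A a -> A (invmx a),
      compact A
    & forall a, A a -> aut_gQh br hp a].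

Definition A_invariant (A : set 'M[R]_n) p : Prop :=
  forall a x, A a -> inspace p x -> inspace p (x *m a).

Definition Pset br hp (A : set 'M[R]_n) : set 'M[R]_n :=
  [set p | subalg br p /\ A_invariant A p /\ strict_subsp hp p].

Definition inF M (a : R) x : Prop :=
  exists (k : nat) (v : 'I_k -> 'rV[R]_n) (lam : 'I_k -> R),
    (forall i, v i *m M = lam i *: v i /\ lam i <= a) /\ x = \sum_(i < k) v i.

Definition filtering br M : Prop :=
  forall (a b : R) x y, inF M a x -> inF M b y -> inF M (a + b) (br x y).

Definition nonneg_spectrum M : Prop :=
  forall x (lam : R), x != 0 -> x *m M = lam *: x -> 0 <= lam.

Definition Fplus br : set 'M[R]_n :=
  [set M | [/\ symmetric_op M, filtering br M, nonneg_spectrum M & \tr M = 1]].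

Definition chibar p : 'M[R]_n := ((n - \rank p)%:R)^-1 *: (1%:M - p).

Definition Dset br (A : set 'M[R]_n) p : set 'M[R]_n :=
  [set M | [/\ p <> 1%:M, symmetric_op M, nonneg_spectrum M & \tr M = 1] /\
            [/\ forall a, A a -> a *m M = M *m a,
              forall x, inspace p x -> x *m M = 0
            & forall X Y, inspace p X -> br X (Y *m M) = br X Y *m M]].

Definition Xset br A p : set 'M[R]_n := Dset br A p `&` Fplus br.

Inductive version := VX | VD.

Definition Bk (v : version) br A p : set 'M[R]_n :=
  match v with VX => Xset br A p | VD => Dset br A p end.

(* flags: nonempty strictly decreasing lists, head = max *)
Definition is_flag_in (S : set 'M[R]_n) (s : seq 'M[R]_n) : Prop :=
  [/\ s <> [::], (forall f, f \in s -> S f)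
    & forall i, (i.+1 < size s)%N -> strict_subsp s`_i.+1 s`_i].

Definition hull (s : seq 'M[R]_n) : set 'M[R]_n :=
  [set M | exists t : 'I_(size s) -> R,
      [/\ forall i, 0 <= t i, \sum_i t i = 1
        & M = \sum_i t i *: chibar s`_i]].

Definition segment_join (S T : set 'M[R]_n) : set 'M[R]_n :=
  [set M | exists P Q (t : R), [/\ S P, T Q, 0 <= t <= 1 & M = (1 - t) *: P + t *: Q]].

Definition butterfly (v : version) br A (s : seq 'M[R]_n) : set 'M[R]_n :=
  match s with
  | [::] => set0
  | [:: f] => Bk v br A f
  | f :: rest => if f == 1%:M then hull rest else segment_join (Bk v br A f) (hull rest)
  end.

Definition Bflags v br A (Phi : set (seq 'M[R]_n)) : set 'M[R]_n :=
  \bigcup_(s in Phi) butterfly v br A s.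

Definition IIflags (P I : set 'M[R]_n) : set (seq 'M[R]_n) :=
  [set s | [/\ is_flag_in P s, ~ is_flag_in I s & forall f, f \in behead s -> I f]].

Definition JJflags (P I : set 'M[R]_n) : set (seq 'M[R]_n) :=
  [set s | IIflags P I s /\ 1%:M \in s].

Inductive polyfun : ('M[R]_n -> R) -> Prop :=
  | pf_const (c : R) : polyfun (fun _ => c)
  | pf_coord (i j : 'I_n) : polyfun (fun M => M i j)
  | pf_add f g : polyfun f -> polyfun g -> polyfun (fun M => f M + g M)
  | pf_mul f g : polyfun f -> polyfun g -> polyfun (fun M => f M * g M).

Inductive semialgebraic : set 'M[R]_n -> Prop :=
  | sa_pos f : polyfun f -> semialgebraic [set M | 0 < f M]
  | sa_zero f : polyfun f -> semialgebraic [set M | f M = 0]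
  | sa_compl S : semialgebraic S -> semialgebraic (~` S)
  | sa_union S T : semialgebraic S -> semialgebraic T -> semialgebraic (S `|` T)
  | sa_inter S T : semialgebraic S -> semialgebraic T -> semialgebraic (S `&` T).

Definition order_ideal (P I : set 'M[R]_n) : Prop :=
  I `<=` P /\ forall l j, P l -> I j -> subsp l j -> I l.

Definition admissible (P I : set 'M[R]_n) : Prop :=
  [/\ order_ideal P I, ~ I 1%:M, compact I & semialgebraic I] /\
  compact (P `\` I) /\ semialgebraic (P `\` I).

Definition strong_deformation_retract (Y A : set 'M[R]_n) : Prop :=
  A `<=` Y /\
  exists H : 'M[R]_n * R -> 'M[R]_n,
    [/\ {within Y `*` `[0, 1], continuous H},
        forall (x : 'M[R]_n) (t : R), Y x -> 0 <= t <= 1 -> Y (H (x, t)),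
        forall x : 'M[R]_n, Y x -> H (x, 0) = x,
        forall x : 'M[R]_n, Y x -> A (H (x, 1))
      & forall (a : 'M[R]_n) (t : R), A a -> 0 <= t <= 1 -> H (a, t) = a].

End Defs.

(* Main.v *)
Require Import Defs.
From HB Require Import structures.
From mathcomp Require Import all_boot all_order all_algebra.
From mathcomp Require Import all_classical all_reals all_analysis.
From mathcomp Require Import ring lra.
Import numFieldNormedType.Exports.
Set Implicit Arguments.
Unset Strict Implicit.
Unset Printing Implicit Defensive.
Import Order.TTheory GRing.Theory Num.Theory.
Local Open Scope classical_set_scope.
Local Open Scope ring_scope.

(** A point [M] of [B[II]] splits as [M = N + \sum_i c_i (1 - f_i)] with [c_i >= 0]
    and [f_i] a chain in [I], where [N >= 0] is supported on the orthogonal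
    complement of some [f] in [P \ I] containing the chain; it lies in [B[JJ]]
    exactly when one may take [N = 0].  With [s = \sum_i c_i], [N] is the positive
    part of [M - s].  By compactness, [tr (f (1 - j))] is bounded below by some
    [delta > 0] for [f] in [P \ I] and [j] in [I].  For two points with [s <= s'],
    the positive part of [M' - s] pairs with [f] to at least [delta (s' - s)],
    while that of [M - s] is orthogonal to [f]; as taking positive parts is
    1-Lipschitz for the Frobenius norm, [s] and hence [N] are Lipschitz
    functions of [M].  The retraction moves [M] along the segment to [N / tr N]. *)

(** * The Frobenius inner product and positive parts *)

Section Frobenius.
Variables (R : realType) (n : nat).
Implicit Types (A B C M N L p q f : 'M[R]_n).

Definition frob A B : R := \tr (A *m B^T).

Lemma frobE A B : frob A B = \sum_i \sum_j A i j * B i j.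
Proof.
by apply: eq_bigr => i _; rewrite mxE; apply: eq_bigr => j _; rewrite mxE.
Qed.

Lemma frobC A B : frob A B = frob B A.
Proof. by rewrite !frobE; do 2 !apply: eq_bigr => ? _; rewrite mulrC. Qed.

Lemma frobDl A B C : frob (A + B) C = frob A C + frob B C.
Proof. by rewrite /frob mulmxDl mxtraceD. Qed.

Lemma frobZl a A C : frob (a *: A) C = a * frob A C.
Proof. by rewrite /frob -scalemxAl mxtraceZ. Qed.

Lemma frobBl A B C : frob (A - B) C = frob A C - frob B C.
Proof. by rewrite -scaleN1r frobDl frobZl mulN1r. Qed.

Lemma frob_suml k (F : 'I_k -> 'M[R]_n) C :
  frob (\sum_i F i) C = \sum_i frob (F i) C.
Proof. by rewrite /frob mulmx_suml raddf_sum. Qed.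

Lemma frobDr A B C : frob C (A + B) = frob C A + frob C B.
Proof. by rewrite ![frob C _]frobC frobDl. Qed.

Lemma frobZr a A C : frob C (a *: A) = a * frob C A.
Proof. by rewrite ![frob C _]frobC frobZl. Qed.

Lemma frobBr A B C : frob C (A - B) = frob C A - frob C B.
Proof. by rewrite ![frob C _]frobC frobBl. Qed.

Lemma frob_sumr k (F : 'I_k -> 'M[R]_n) C :
  frob C (\sum_i F i) = \sum_i frob C (F i).
Proof. by rewrite frobC frob_suml; apply: eq_bigr => i _; rewrite frobC. Qed.

Lemma frob_ge0 A : 0 <= frob A A.
Proof. by rewrite frobE; do 2 !apply: sumr_ge0 => ? _; rewrite -expr2 sqr_ge0. Qed.

Lemma frobNN A : frob (- A) (- A) = frob A A.
Proof. by rewrite /frob linearN/= mulNmx mulmxN opprK. Qed.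

Lemma coef_sqr_le_frob A i j : A i j ^+ 2 <= frob A A.
Proof.
rewrite frobE (bigD1 i)//= (bigD1 j)//= -expr2 -addrA lerDl addr_ge0//.
  by apply: sumr_ge0 => k _; rewrite -expr2 sqr_ge0.
by do 2 !apply: sumr_ge0 => ? _; rewrite -expr2 sqr_ge0.
Qed.

Lemma frob_eq0 A : frob A A <= 0 -> A = 0.
Proof.
move=> A0; apply/matrixP => i j; rewrite mxE; apply/eqP.
by rewrite -sqrf_eq0 eq_le sqr_ge0 (le_trans (coef_sqr_le_frob A i j)).
Qed.

Definition orthoproj p := p^T = p /\ p *m p = p.

Lemma orthoproj1 : orthoproj 1%:M.
Proof. by split; rewrite ?trmx1 ?mulmx1. Qed.

Lemma orthoproj_compl p : orthoproj p -> orthoproj (1%:M - p).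
Proof.
move=> [pT pp]; split; first by rewrite linearB/= trmx1 pT.
by rewrite mulmxBl !mulmxBr !mulmx1 !mul1mx pp subrr subr0.
Qed.

Lemma frob_proj p q : orthoproj p -> orthoproj q -> frob p q = frob (p *m q) (p *m q).
Proof.
move=> [pT pp] [qT qq]; rewrite /frob trmx_mul pT qT.
by rewrite mulmxA -[p *m q *m q]mulmxA qq [RHS]mxtrace_mulC mulmxA pp.
Qed.

Lemma frob_proj_ge0 p q : orthoproj p -> orthoproj q -> 0 <= frob p q.
Proof. by move=> hp hq; rewrite frob_proj// frob_ge0. Qed.

Lemma frob_proj_le p : orthoproj p -> frob p p <= n%:R.
Proof.
move=> hp; have := frob_proj_ge0 (orthoproj_compl hp) (orthoproj_compl hp).
have h q : orthoproj q -> frob q q = \tr q by case=> qT qq; rewrite /frob qT qq.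
by rewrite !h//; [rewrite linearB/= mxtrace1 subr_ge0|exact: orthoproj_compl].
Qed.

(* Testing against projections only is equivalent to positivity for symmetric
   [N], and needs no spectral decomposition. *)
Definition psd N := forall p, orthoproj p -> 0 <= frob N p.

(** The dual cone of [psd] for the Frobenius pairing. It visibly contains the nonnegative
    combinations of projections. *)
Definition copsd L := forall N, psd N -> 0 <= frob N L.

(** Moreau decomposition: [N] is the point of the cone [psd] nearest to [C], and [- L] lies in the
    polar cone. *)
Definition pos_part C N :=
  exists L, [/\ C = N - L, psd N, copsd L & frob N L = 0].

(** Projection onto a convex cone is nonexpansive: with [D = N - N'] and [G = L - L'], the cross
    term [frob D G = - frob N L' - frob N' L] is at most 0, so [|D - G|^2 >= |D|^2]. *)
Lemma pos_part_contract C N C' N' : pos_part C N -> pos_part C' N' ->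
  frob (N - N') (N - N') <= frob (C - C') (C - C').
Proof.
move=> [L [-> pN pL NL]] [L' [-> pN' pL' NL']].
have -> : N - L - (N' - L') = (N - N') - (L - L').
  by rewrite !opprB [in RHS]addrC [LHS]addrACA [RHS]addrACA [N + L']addrC.
have h1 := pL _ pN'; have h2 := pL' _ pN.
have : frob (N - N') (L - L') <= 0 by rewrite frobBl !frobBr NL NL'; lra.
move: (N - N') (L - L') => D G; have := frob_ge0 G.
by rewrite frobBl !frobBr [frob G D]frobC; lra.
Qed.

End Frobenius.

(* Mass [s] is removed from the end of the list of weights. *)
Lemma truncate_weights (R : realType) k (c : nat -> R) s :
    (forall i, (i < k)%N -> 0 <= c i) -> 0 <= s <= \sum_(i < k) c i ->
  exists d : nat -> R,
    [/\ forall i, (i < k)%N -> 0 <= d i <= c i,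
        \sum_(i < k) d i = \sum_(i < k) c i - s
      & forall i j, (j < i < k)%N -> d i = 0 \/ d j = c j].
Proof.
elim: k c s => [|k IH] c s c0 /andP[s0].
  rewrite big_ord0 => s0'; have -> : s = 0 by apply/le_anti/andP.
  by exists c; split=> [//||i j /andP[]//]; rewrite !big_ord0 subr0.
rewrite big_ord_recl => sc; have {}sc : s <= c 0 + \sum_(i < k) c i.+1 by [].
have c1 i : (i < k)%N -> 0 <= c i.+1 by move=> ik; apply: c0.
have [s_le|s_gt] := leP s (\sum_(i < k) c i.+1).
  have [|d [d0 ds dc]] := IH (fun i => c i.+1) s c1; first by rewrite s0 s_le.
  exists (fun i => if i is i'.+1 then d i' else c 0); split.
  - by case=> [_|i]; [rewrite lexx c0|exact: d0].
  - by rewrite !big_ord_recl/= ds addrA.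
  - by case=> [|i] [|j]//; [right|exact: dc].
exists (fun i => if i is i'.+1 then 0 else c 0 + \sum_(i < k) c i.+1 - s); split.
- case=> [_|i]; last by move=> ik; rewrite lexx c0.
  by rewrite subr_ge0 sc lerBlDr lerD2l ltW.
- by rewrite big_ord_recl/= [X in _ + X]big1// addr0.
- by case=> [|i] // j _; left.
Qed.

(** * Decompositions along chains and their Lipschitz dependence on the point *)

Section Decomposition.
Variables (R : realType) (n : nat).
Implicit Types (M N f p : 'M[R]_n) (I S : set 'M[R]_n).

(** Inclusions are written as products of projections: [F i *m F j = F j] means that [F j] lies in
    [F i]. The weights [c] absorb the dimension factors of [chibar]. *)
Definition chain_decomp I S M s N := exists f k (F : nat -> 'M[R]_n) (c : nat -> R),
  [/\ S f, forall i, (i < k)%N -> I (F i),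
      forall i j, (i <= j < k)%N -> F i *m F j = F j
    & forall i, (i < k)%N -> f *m F i = F i] /\
  [/\ forall i, (i < k)%N -> 0 <= c i, s = \sum_(i < k) c i,
      N *m f = 0, psd N & M = N + \sum_(i < k) c i *: (1%:M - F i)].

Variables (I S : set 'M[R]_n) (delta : R).
Hypotheses (I_proj : forall p, I p -> orthoproj p)
  (S_proj : forall p, S p -> orthoproj p) (delta_gt0 : 0 < delta)
  (delta_le : forall j f, I j -> S f -> delta <= frob (1%:M - j) f).

Lemma copsd_proj_sum k (F : nat -> 'M[R]_n) (c : nat -> R) :
    (forall i, (i < k)%N -> I (F i)) -> (forall i, (i < k)%N -> 0 <= c i) ->
  copsd (\sum_(i < k) c i *: F i).
Proof.
move=> IF c0 N pN; rewrite frob_sumr; apply: sumr_ge0 => i _.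
by rewrite frobZr mulr_ge0 ?c0// pN//; apply/I_proj/IF.
Qed.

Lemma psd_add_compl_sum N k (F : nat -> 'M[R]_n) (c : nat -> R) :
    psd N -> (forall i, (i < k)%N -> I (F i)) ->
    (forall i, (i < k)%N -> 0 <= c i) ->
  psd (N + \sum_(i < k) c i *: (1%:M - F i)).
Proof.
move=> pN IF c0 p pp; rewrite frobDl frob_suml addr_ge0 ?pN//.
apply: sumr_ge0 => i _; rewrite frobZl mulr_ge0 ?c0//.
by apply: frob_proj_ge0 => //; apply/orthoproj_compl/I_proj/IF.
Qed.

(** As [s] is the sum of the weights, [M - s = N - \sum_i c_i F_i]; each [F i] lies in [f], hence is
    orthogonal to [N]. *)
Lemma decomp_pos_part M s N : chain_decomp I S M s N -> pos_part (M - s%:M) N.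
Proof.
move=> [f [k [F [c [[Sf IF FF fF] [c0 -> Nf pN ->]]]]]].
exists (\sum_(i < k) c i *: F i); split=> //.
- rewrite -addrA; congr (_ + _); under eq_bigr do rewrite scalerBr.
  rewrite big_split/= sumrN addrAC -[RHS]add0r; congr (_ + _).
  by rewrite -scaler_suml scalemx1 subrr.
- exact: copsd_proj_sum.
- rewrite frob_sumr big1// => i _; rewrite frobZr /frob (I_proj (IF i _)).1//.
  by rewrite -(fF i)// mulmxA Nf mul0mx mxtrace0 mulr0.
Qed.

(** Subtracting [s0] consumes mass from the smallest members of the chain first. The surviving
    weights [d] have sum [s - s0], and each [1 - F i] pairs with [f] to at least [delta]. *)
Lemma truncated_pos_part M s N s0 : chain_decomp I S M s N -> 0 <= s0 <= s ->
  exists2 N0, pos_part (M - s0%:M) N0 &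
    forall f, S f -> delta * (s - s0) <= frob N0 f.
Proof.
move=> [f [k [F [c [[Sf IF FF fF] [c0 -> Nf pN ->]]]]]] s0s.
have [d [d0 ds dc]] := truncate_weights c0 s0s.
have d_ge0 i : (i < k)%N -> 0 <= d i by move=> /d0/andP[].
have NF i : (i < k)%N -> frob N (F i) = 0.
  move=> ik; rewrite /frob (I_proj (IF i ik)).1.
  by rewrite -(fF i)// mulmxA Nf mul0mx mxtrace0.
have FcF i j : (i <= j < k)%N -> frob (1%:M - F i) (F j) = 0.
  move=> ijk; have /andP[_ jk] := ijk; rewrite /frob (I_proj (IF j jk)).1.
  by rewrite mulmxBl mul1mx FF// subrr mxtrace0.
exists (N + \sum_(i < k) d i *: (1%:M - F i)).
  exists (\sum_(i < k) (c i - d i) *: F i); split.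
  - rewrite -!addrA; congr (_ + _).
    have -> : s0%:M = \sum_(i < k) (c i - d i)%:M :> 'M[R]_n.
      by rewrite -raddf_sum/= sumrB ds opprB addrC subrK.
    rewrite -!sumrB; apply: eq_bigr => i _; apply/matrixP => a b.
    by rewrite !mxE; case: (a == b); rewrite ?mulr1n ?mulr0n; ring.
  - exact: psd_add_compl_sum.
  - apply: (@copsd_proj_sum k F (fun i => c i - d i)) => // i ik.
    by rewrite subr_ge0; have /andP[] := d0 i ik.
  - rewrite frobDl frob_sumr big1 ?add0r; last first.
      by move=> i _; rewrite frobZr NF// mulr0.
    rewrite frob_suml big1// => i _; rewrite frob_sumr big1// => j _.
    (* For [i <= j], [1 - F i] and [F j] are orthogonal; for [j < i], truncation from the end gives
       [d i = 0] or [d j = c j]. *)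
    rewrite frobZr frobZl; have [ij|ji] := leqP i j.
      by rewrite FcF ?ij//= !mulr0.
    have [| ->|->] := dc i j; first by rewrite ji/=.
      by rewrite mul0r mulr0.
    by rewrite subrr mul0r.
move=> g Sg; rewrite frobDl frob_suml -[leLHS]add0r lerD ?pN//; first exact: S_proj.
rewrite -ds mulr_sumr; apply: ler_sum => i _; rewrite frobZl mulrC.
by rewrite ler_wpM2l ?d_ge0// delta_le//; apply: IF.
Qed.

Lemma decomp_level_ge0 M s N : chain_decomp I S M s N -> 0 <= s.
Proof.
by move=> [f [k [F [c [_ [c0 -> _ _ _]]]]]]; apply: sumr_ge0 => i _; apply: c0.
Qed.

(** [n.+1] bounds [frob f f] and, unlike [n], is always positive, so that one may divide by it. *)
Let K := n.+1%:R / delta ^+ 2.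

(** Both positive parts are taken at the lower level [s], where the scalar shifts cancel.
    Contraction bounds [|N0 - N|] by [|M' - M|], while pairing with [f] bounds it below by a
    multiple of [s' - s]. *)
Lemma decomp_level_dist M s N M' s' N' :
    chain_decomp I S M s N -> chain_decomp I S M' s' N' ->
  (s' - s) ^+ 2 <= K * frob (M' - M) (M' - M).
Proof.
wlog ss' : M s N M' s' N' / s <= s'.
  move=> H D D'; have [h|/ltW h] := leP s s'; first exact: H D D'.
  by rewrite -[s' - s]opprB sqrrN -[M' - M]opprB frobNN; exact: H D' D.
move=> D D'; have [|N0 pN0 N0S] := @truncated_pos_part _ _ _ s D'.
  by rewrite (decomp_level_ge0 D).
have pN := decomp_pos_part D.
have le1 := pos_part_contract pN0 pN.
have [f [k [F [c [[Sf _ _ _] [_ _ Nf _ _]]]]]] := D.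
have le2 := N0S f Sf.
have Nf0 : frob N f = 0 by rewrite /frob (S_proj Sf).1 Nf mxtrace0.
rewrite opprB addrA subrK in le1.
have le3 : delta * (s' - s) <= frob (N0 - N) f by rewrite frobBl Nf0 subr0.
have le4 := frob_proj_le (S_proj Sf).
have n0 : 0 < n.+1%:R :> R by rewrite ltr0n.
move: le1 le3; set y := delta * _; set E := frob (M' - M) _ => le1 le3.
(* Cauchy-Schwarz, obtained from [0 <= |a f - (N0 - N)|^2]; this [a] maximises
   [2 a y - a^2 (n + 1)]. *)
set a := y / n.+1%:R.
have a0 : 0 <= a by rewrite divr_ge0 ?mulr_ge0 ?(ltW delta_gt0)// subr_ge0.
have le5 : a ^+ 2 * frob f f <= a ^+ 2 * n.+1%:R.
  by rewrite ler_wpM2l ?sqr_ge0// (le_trans le4)// ler_nat.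
have le6 : a * y <= a * frob (N0 - N) f by rewrite ler_wpM2l.
have le7 : a * y <= E.
  have ->  : a * y = a * y *+ 2 - a ^+ 2 * n.+1%:R.
    by rewrite expr2 -[a * a * _]mulrA [a * n.+1%:R]divfK ?gt_eqF// mulr2n addrK.
  have := frob_ge0 (a *: f - (N0 - N)).
  move: (N0 - N) le1 le6 => D0 le1 le6.
  rewrite frobBl !frobBr !frobZl !frobZr [frob f D0]frobC.
  by move: le5; rewrite expr2; lra.
rewrite /K mulrAC ler_pdivlMr ?exprn_gt0// -exprMn [_ * delta]mulrC -/y.
by rewrite [leRHS]mulrC -ler_pdivrMr// expr2 mulrAC.
Qed.

(** Contraction, with each point at its own level, leaves [E = M' - M] minus the scalar
    [x = s' - s]. The constant comes from [|E - x|^2 <= 2 |E|^2 + 2 n x^2] and the bound on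
    [x^2]. *)
Lemma decomp_pos_dist M s N M' s' N' :
    chain_decomp I S M s N -> chain_decomp I S M' s' N' ->
  frob (N' - N) (N' - N) <= (2 + 2 * n%:R * K) * frob (M' - M) (M' - M).
Proof.
move=> D D'; have le1 := decomp_level_dist D D'.
have := pos_part_contract (decomp_pos_part D')
  (decomp_pos_part D).
have -> : M' - s'%:M - (M - s%:M) = (M' - M) - (s' - s)%:M.
  apply/matrixP => i j; rewrite !mxE.
  by case: (i == j); rewrite ?mulr1n ?mulr0n; ring.
move: (M' - M) (s' - s) le1 => E x le1.
have le2 := frob_ge0 (E + x%:M).
have le3 : frob (x%:M : 'M[R]_n) x%:M = n%:R * x ^+ 2.
  by rewrite /frob tr_scalar_mx -scalar_mxM mxtrace_scalar mulr_natl.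
have : n%:R * x ^+ 2 <= n%:R * (K * frob E E) by rewrite ler_wpM2l.
move: (N' - N) le2 => D0.
by rewrite frobBl !frobBr frobDl !frobDr le3; lra.
Qed.

(** Uniqueness is the Lipschitz estimate at distance zero. *)
Lemma decomp_inj M s N s' N' :
  chain_decomp I S M s N -> chain_decomp I S M s' N' -> N = N'.
Proof.
move=> D D'; have := decomp_pos_dist D' D.
by rewrite subrr /frob mul0mx mxtrace0 mulr0 => /frob_eq0/eqP; rewrite subr_eq0 => /eqP.
Qed.

End Decomposition.

Lemma cvg_sumr (R : realType) (T : Type) (F : set_system T) (FF : Filter F) k
    (f : 'I_k -> T -> R) (a : 'I_k -> R) :
  (forall i, f i x @[x --> F] --> a i) ->
  \sum_i f i x @[x --> F] --> \sum_i a i.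
Proof. by move=> fa; apply: cvg_big => //; exact: add_continuous. Qed.

(** * From nonnegative spectrum to positivity; inclusions of projections *)

Section Spectrum.
Variables (R : realType) (n : nat).
Implicit Types (x y : 'rV[R]_n) (M p q : 'M[R]_n).

Lemma dotE x y : dot x y = (x *m y^T) 0 0.
Proof. by rewrite mxE; apply: eq_bigr => i _; rewrite mxE. Qed.

Lemma dotDl x y z : dot (x + y) z = dot x z + dot y z.
Proof. by rewrite !dotE mulmxDl mxE. Qed.

Lemma dotZl a x z : dot (a *: x) z = a * dot x z.
Proof. by rewrite !dotE -scalemxAl mxE. Qed.

Lemma dotC x y : dot x y = dot y x.
Proof. by apply: eq_bigr => i _; rewrite mulrC. Qed.

Lemma dotDr x y z : dot z (x + y) = dot z x + dot z y.
Proof. by rewrite ![dot z _]dotC dotDl. Qed.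

Lemma dotZr a x z : dot z (a *: x) = a * dot z x.
Proof. by rewrite ![dot z _]dotC dotZl. Qed.

Lemma coef_sqr_le_dot x i : x 0 i ^+ 2 <= dot x x.
Proof.
rewrite /dot (bigD1 i)//= -expr2 lerDl.
by apply: sumr_ge0 => j _; rewrite -expr2 sqr_ge0.
Qed.

Lemma dot_ge0 x : 0 <= dot x x.
Proof. by apply: sumr_ge0 => i _; rewrite -expr2 sqr_ge0. Qed.

Lemma dot_eq0 x : dot x x = 0 -> x = 0.
Proof.
move=> x0; apply/rowP => i; rewrite mxE; apply/eqP.
by rewrite -sqrf_eq0 eq_le sqr_ge0 andbT -x0 coef_sqr_le_dot.
Qed.

Lemma dot_delta x i : dot x (delta_mx 0 i) = x 0 i.
Proof.
rewrite /dot (bigD1 i)//= mxE !eqxx mulr1 big1 ?addr0// => k /negPf ki.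
by rewrite mxE ki andbF mulr0.
Qed.

Lemma symmetric_opP M : symmetric_op M <-> M^T = M.
Proof.
split=> [sM|MT x y]; last by rewrite !dotE trmx_mul MT mulmxA.
apply/matrixP => i j; rewrite mxE.
have := sM (delta_mx 0 j) (delta_mx 0 i).
by rewrite [RHS]dotC !dot_delta -!rowE !mxE.
Qed.

Lemma is_projP p : is_proj p <-> orthoproj p.
Proof. by rewrite /is_proj symmetric_opP. Qed.

Lemma continuous_dot_mul M : continuous (fun x => dot (x *m M) x).
Proof.
move=> x; apply: (@cvg_sumr _ _ (nbhs x)) => i.
apply: cvgM; last exact: coord_continuous.
rewrite mxE; under eq_fun do rewrite mxE.
apply: (@cvg_sumr _ _ (nbhs x)) => j.
by apply: cvgM; [exact: coord_continuous|exact: cvg_cst].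
Qed.

Lemma compact_sphere : compact [set x : 'rV[R]_n | dot x x = 1].
Proof.
apply: (@subclosed_compact _ _
    [set x : 'rV[R]_n | forall i, x ord0 i \in `[(-1 : R), 1]]).
- have -> : [set x : 'rV[R]_n | dot x x = 1] =
      (fun x => dot (x *m 1%:M) x) @^-1` [set 1].
    by apply/seteqP; split=> x /=; rewrite mulmx1.
  apply: preimage_closed; last exact: closed_eq.
  by move=> x _; exact: continuous_dot_mul.
- by apply: (@rV_compact R n (fun=> `[-1, 1]%classic)) => _; exact: segment_compact.
- move=> x /= x1 i; have := coef_sqr_le_dot x i; rewrite x1 in_itv/= expr2 => xi.
  by apply/andP; split; nra.
Qed.

(* A minimiser [w] of the quadratic form on the sphere is an eigenvector: the
   form [<(M - mu) x, x>] is nonnegative and vanishes at [w]. *)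
Lemma nonneg_spectrum_dot M x :
  symmetric_op M -> nonneg_spectrum M -> 0 <= dot (x *m M) x.
Proof.
move=> sM nM; have [->|x0] := eqVneq x 0.
  by rewrite mul0mx dotE mul0mx mxE.
have normalize y : y != 0 -> exists2 r : R, 0 < r & dot (r *: y) (r *: y) = 1.
  move=> y0; have y1 : 0 < dot y y.
    by rewrite lt_def dot_ge0 andbT; apply: contraNneq y0 => /dot_eq0 ->.
  exists (Num.sqrt (dot y y))^-1; first by rewrite invr_gt0 sqrtr_gt0.
  by rewrite dotZl dotZr mulrA -expr2 exprVn sqr_sqrtr ?ltW// mulVf ?gt_eqF.
have [r0 _ r0x] := normalize _ x0.
have [||w] := EVT_min_rV (f := fun y => dot (y *m M) y) _ compact_sphere.
- by exists (r0 *: x).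
- by apply: continuous_subspaceT; exact: continuous_dot_mul.
rewrite inE/= => w1 wmin; set mu := dot (w *m M) w in wmin.
have q_ge0 y : mu * dot y y <= dot (y *m M) y.
  have [->|/normalize[r r_gt0 ry]] := eqVneq y 0.
    by rewrite mul0mx !dotE mul0mx mxE mulr0.
  have := wmin (r *: y); rewrite inE => /(_ ry).
  move: ry; rewrite -scalemxAl !dotZl !dotZr !mulrA -expr2 => ry le_mu.
  by rewrite -(ler_pM2l (exprn_gt0 2 r_gt0)) mulrCA ry mulr1.
have wM : w *m M = mu *: w.
  apply/eqP; rewrite -subr_eq0; apply/eqP/dot_eq0.
  set z := w *m M - mu *: w.
  have zE : dot (w *m M) z - mu * dot w z = dot z z.
    by rewrite -dotZl -mulN1r -dotZl -dotDl scaleN1r.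
  have qz : 0 <= dot (z *m M) z - mu * dot z z by rewrite subr_ge0.
  apply/eqP; rewrite eq_le dot_ge0 andbT leNgt; apply/negP => z_gt0.
  set b := dot (z *m M) z - mu * dot z z in qz.
  (* With [q x = <(M - mu) x, x>], one has [q (w + e z) = 2 e <z, z> + e^2 b]. This [e] makes it
     [e <z, z> - e^2 < 0]; adding 1 to [b >= 0] avoids a zero denominator. *)
  pose e := - (dot z z / (b + 1)).
  have := q_ge0 (w + e *: z).
  rewrite mulmxDl -scalemxAl !dotDl !dotDr !dotZl !dotZr.
  rewrite [dot (z *m M) w]sM [dot z (w *m M)]dotC [dot z w]dotC w1 -/mu.
  have b1 : 0 < b + 1 by lra.
  have e_lt0 : e < 0 by rewrite /e oppr_lt0 divr_gt0.
  have eb : e * (b + 1) = - dot z z by rewrite /e mulNr divfK ?gt_eqF.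
  have : 0 < e ^+ 2 by rewrite exprn_even_gt0//= lt_eqF.
  have eu : e * dot z z < 0 by rewrite nmulr_rlt0.
  have /(congr1 ( *%R e)) := eb; have /(congr1 ( *%R e)) := zE.
  by rewrite /b expr2; lra.
have w0 : w != 0.
  by apply: contra_eq_neq w1 => ->; rewrite dotE mul0mx mxE eq_sym oner_eq0.
by apply: le_trans (q_ge0 x); rewrite mulr_ge0 ?dot_ge0// (nM w mu w0 wM).
Qed.

(** [frob M p] is the trace of [p *m M *m p], whose diagonal entries are values of the quadratic
    form of [M] at the rows of [p]. *)
Lemma nonneg_spectrum_psd M : symmetric_op M -> nonneg_spectrum M -> psd M.
Proof.
move=> sM nM p [pT pp]; rewrite /frob pT -pp mulmxA mxtrace_mulC mulmxA.
apply: sumr_ge0 => i _.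
suff -> : (p *m M *m p) i i = dot (row i p *m M) (row i p).
  exact: nonneg_spectrum_dot.
rewrite -row_mul mxE; apply: eq_bigr => j _; congr (_ * _).
  by rewrite [RHS]mxE.
by rewrite [RHS]mxE -[in LHS]pT mxE.
Qed.

Lemma subspP p q : orthoproj p -> orthoproj q -> subsp p q -> q *m p = p.
Proof.
move=> [pT pp] [qT _] pq.
have pqp : p *m q = p.
  apply/row_matrixP => i; rewrite row_mul; apply: pq.
  by rewrite /inspace -row_mul pp.
by rewrite -[RHS]pT -[in RHS]pqp trmx_mul pT qT.
Qed.

Lemma subsp_of_mul p q : p *m q = p -> subsp p q.
Proof. by move=> pq x xp; rewrite /inspace -xp -mulmxA pq. Qed.

End Spectrum.

(** * Convergence of matrices and a compactness gap *)

Section Convergence.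
Variables (R : realType) (n : nat).
Implicit Types (M N : 'M[R]_n).

Lemma cvg_mx_coef T (F : set_system T) (FF : Filter F) (f : T -> 'M[R]_n) M :
  (forall i j, f x i j @[x --> F] --> M i j) -> f @ F --> M.
Proof.
move=> fM U [V MV VU]; suff : \forall x \near F, forall i j, V i j (f x i j).
  by apply: filterS => x; exact: VU.
by apply: filter_forall => i; apply: filter_forall => j; exact: fM (MV i j).
Qed.

Lemma cvg_frob T (F : set_system T) (FF : Filter F) (f g : T -> 'M[R]_n) M N :
    (forall i j, f x i j @[x --> F] --> M i j) ->
    (forall i j, g x i j @[x --> F] --> N i j) ->
  frob (f x) (g x) @[x --> F] --> frob M N.
Proof.
move=> fM gN; rewrite frobE; under eq_fun do rewrite frobE.
by do 2 apply: cvg_sumr => ?; exact: cvgM.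
Qed.

Lemma cvg_coefB T (F : set_system T) (FF : Filter F) (f g : T -> 'M[R]_n) M N i j :
    f x i j @[x --> F] --> M i j -> g x i j @[x --> F] --> N i j ->
  (f x - g x) i j @[x --> F] --> (M - N) i j.
Proof.
move=> fM gN; rewrite mxE [(- N) i j]mxE.
by under eq_fun do rewrite mxE [(- g _) i j]mxE; exact: cvgB.
Qed.

Lemma cvg_frob_dist M :
  frob (M' - M) (M' - M) @[M' --> M] --> (0 : R).
Proof.
have -> : 0 = frob (M - M) (M - M) by rewrite subrr /frob mul0mx mxtrace0.
by apply: (@cvg_frob _ (nbhs M)) => i j; apply: (@cvg_coefB _ (nbhs M));
  [exact: coord_continuous|exact: cvg_cst|exact: coord_continuous|exact: cvg_cst].
Qed.

Lemma frob_lipschitz_cvg (Y : set 'M[R]_n) (f : 'M[R]_n -> 'M[R]_n) (K : R) :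
    0 < K ->
    (forall M M', Y M -> Y M' ->
      frob (f M' - f M) (f M' - f M) <= K * frob (M' - M) (M' - M)) ->
  forall M i j, Y M -> f M' i j @[M' --> within Y (nbhs M)] --> f M i j.
Proof.
move=> K0 fK M i j YM; apply/cvgrPdist_le => e e0.
have /cvgrPdist_le/(_ (e ^+ 2 / K)) := cvg_frob_dist M.
rewrite divr_gt0 ?exprn_gt0// => /(_ isT) near_e.
rewrite near_withinE; apply: filterS near_e => M' /= le_e YM'.
rewrite sub0r normrN ger0_norm ?frob_ge0// in le_e.
have := coef_sqr_le_frob (f M' - f M) i j.
move/le_trans/(_ (fK _ _ YM YM')) => le1.
have le2 : K * frob (M' - M) (M' - M) <= e ^+ 2 by rewrite mulrC -ler_pdivlMr.
have := le_trans le1 le2; rewrite !mxE distrC.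
by rewrite -real_normK ?num_real// ler_pXn2r// nnegrE ?normr_ge0// ltW.
Qed.

(** The pairing attains its minimum on the compact product of [I] and [S]; it equals
    [|(1 - j) f|^2], which vanishes only if [f] lies in [j]. *)
Lemma compact_gap (I S : set 'M[R]_n) : compact I -> compact S ->
    (forall p, I p -> orthoproj p) -> (forall p, S p -> orthoproj p) ->
    (forall j f, I j -> S f -> ~ subsp f j) ->
  exists2 d : R, 0 < d & forall j f, I j -> S f -> d <= frob (1%:M - j) f.
Proof.
move=> cI cS pI pS nsub.
have [IS0|/set0P IS0] := eqVneq (I `*` S) set0.
  by exists 1 => // j f Ij Sf; have : (I `*` S) (j, f) by []; rewrite IS0.
have [|[j f]] := @compact_EVT_min _ _ (fun z : 'M[R]_n * 'M[R]_n =>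
  frob (1%:M - z.1) z.2) _ IS0 (compact_setX cI cS).
  apply: continuous_subspaceT => z.
  apply: (@cvg_frob _ (nbhs z)) => a b; last first.
    apply: (@cvg_comp _ _ _ snd (fun M : 'M[R]_n => M a b) _ (nbhs z.2)).
      exact: cvg_snd.
    exact: coord_continuous.
  apply: (@cvg_coefB _ (nbhs z)); first exact: cvg_cst.
  apply: (@cvg_comp _ _ _ fst (fun M : 'M[R]_n => M a b) _ (nbhs z.1)).
      exact: cvg_fst.
    exact: coord_continuous.
rewrite inE => -[/= Ij Sf] min_jf; exists (frob (1%:M - j) f); last first.
  by move=> j' f' Ij' Sf'; apply: (min_jf (j', f')); rewrite inE.
have pj := pI j Ij; have pf := pS f Sf.
rewrite frob_proj//; last exact: orthoproj_compl.
rewrite ltNge; apply/negP => /frob_eq0/eqP.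
rewrite mulmxBl mul1mx subr_eq0 => /eqP fE; apply: (nsub j f Ij Sf).
apply: subsp_of_mul; rewrite -[RHS]pf.1 [in RHS]fE trmx_mul.
by rewrite pf.1 pj.1.
Qed.

End Convergence.

(** * Decomposing butterflies and building the retraction *)

Section Butterflies.
Variables (R : realType) (n : nat).
Variables (br : 'rV[R]_n -> 'rV[R]_n -> 'rV[R]_n) (hp : 'M[R]_n).
Variables (A I : set 'M[R]_n) (v : version).
Implicit Types (M N P Q f g p : 'M[R]_n) (l : seq 'M[R]_n).

Let PP := Pset br hp A.
Let S := PP `\` I.
Let JJ := Bflags v br A (JJflags PP I).
Let Y := Bflags v br A (IIflags PP I) `\` JJ.

Hypotheses (PP1 : PP 1%:M) (admI : admissible PP I).

Let I_P : I `<=` PP. Proof. by have [[[]]] := admI. Qed.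

Let I_down g f : PP g -> I f -> subsp g f -> I g.
Proof. by have [[[_ h] _ _ _] _] := admI; exact: h. Qed.

Let nI1 : ~ I 1%:M. Proof. by have [[]] := admI. Qed.

Let PP_proj p : PP p -> orthoproj p.
Proof. by move=> [[/is_projP]]. Qed.

Let I_proj p : I p -> orthoproj p. Proof. by move=> /I_P/PP_proj. Qed.

Let S_proj p : S p -> orthoproj p. Proof. by move=> [/PP_proj]. Qed.

(** An [f] in [S] contained in some [j] in [I] would lie in [I], which is downward closed. *)
Lemma ideal_gap :
  exists2 d : R, 0 < d & forall j f, I j -> S f -> d <= frob (1%:M - j) f.
Proof.
have [[_ _ cI _] [cS _]] := admI.
by apply: compact_gap => // j f Ij [Pf nIf] /(I_down Pf Ij).
Qed.

(** Both versions lie in [Dset], which yields all four properties; the rest of the argument is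
    uniform in [v]. *)
Lemma Bk_pos f M : Bk v br A f M ->
  [/\ f <> 1%:M, psd M, \tr M = 1 & orthoproj f -> M *m f = 0].
Proof.
move=> BM; have {}BM : Dset br A f M by case: v BM => // -[].
case: BM => -[f1 sM nM tM] [_ Mf _]; split=> // [|[fT ff]].
  exact: nonneg_spectrum_psd.
apply: trmx_inj; rewrite trmx_mul fT ((symmetric_opP M).1 sM) trmx0.
apply/row_matrixP => i; rewrite row_mul row0; apply: Mf.
by rewrite /inspace -row_mul ff.
Qed.

Lemma flag_subsp s i j : is_flag_in PP s -> (i <= j < size s)%N ->
  subsp s`_j s`_i.
Proof.
move=> [_ _ dec] /andP[]; elim: j => [|j IH]; first by rewrite leqn0 => /eqP-> _ x.
rewrite leq_eqVlt => /predU1P[-> _ x //|ij js x xj].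
by apply: IH => //; [exact: ltnW|exact: (dec j js).1].
Qed.

(** Applied with [N] a multiple of a point of [B[f]], and with [N = 0] when [f = 1%:M]. The chain is
    the tail [l], so its index [i] is [i.+1] in the flag. *)
Lemma decomp_cone f l N Q t : is_flag_in PP (f :: l) -> S f ->
    (forall g, g \in l -> I g) -> psd N -> N *m f = 0 -> hull l Q -> 0 <= t ->
  exists s, chain_decomp I S (N + t *: Q) s N.
Proof.
move=> flag Sf Il pN Nf [w [w0 w1 ->]] t0.
pose w' i := if insub i is Some o then w o else 0.
pose c i := t * w' i * ((n - \rank l`_i)%:R)^-1.
have w'E (o : 'I_(size l)) : w' o = w o by rewrite /w' valK.
exists (\sum_(i < size l) c i), f, (size l), (fun i => l`_i), c.
have IF i : (i < size l)%N -> I l`_i by move=> il; apply: Il; exact: mem_nth.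
split; split=> //.
- move=> i j ijl; have /andP[ij jl] := ijl.
  apply: subspP; [exact/I_proj/IF|exact/I_proj/IF/(leq_ltn_trans ij)|].
  exact: (@flag_subsp (f :: l) i.+1 j.+1).
- move=> i il; apply: subspP; [exact/I_proj/IF|exact: S_proj|].
  exact: (@flag_subsp (f :: l) 0 i.+1).
- move=> i il; rewrite /c (w'E (Ordinal il)).
  by rewrite mulr_ge0 ?invr_ge0 ?ler0n// mulr_ge0.
- rewrite scaler_sumr; congr (_ + _); apply: eq_bigr => i _.
  by rewrite /chibar !scalerA /c w'E.
Qed.

Lemma decomp_single f N : S f -> psd N -> N *m f = 0 -> chain_decomp I S N 0 N.
Proof.
move=> Sf pN Nf; exists f, 0, (fun=> 0), (fun=> 0).
by split; split=> //; rewrite ?big_ord0 ?addr0// => i j; rewrite ltn0 andbF.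
Qed.

Lemma psd0 : psd (0 : 'M[R]_n).
Proof. by move=> p _; rewrite /frob mul0mx mxtrace0. Qed.

Lemma psdZ a N : 0 <= a -> psd N -> psd (a *: N).
Proof. by move=> a0 pN p pp; rewrite frobZl mulr_ge0 ?pN. Qed.

(** As [1%:M] is not in [I], it can only be the head of the flag; the butterfly is then empty or the
    hull of the rest, where [N = 0]. *)
Lemma decomp_JJ M : JJ M -> exists s, chain_decomp I S M s 0.
Proof.
move=> [s [[flag nflag Is] s1]].
case: s flag nflag Is s1 => // f l flag nflag Il.
rewrite inE => /orP[/eqP f1|/Il//]; rewrite -f1 in flag nflag *.
case: l flag nflag Il => [_ _ _ /Bk_pos[]//|g l] flag nflag Il /=.
rewrite eqxx => Ml; rewrite -[M]scale1r -[1 *: M]add0r.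
by apply: decomp_cone (flag) _ _ psd0 _ Ml _ => //; rewrite ?mul0mx.
Qed.

(** Points of [JJ] have a decomposition with [N = 0], and [N] is unique. *)
Lemma decomp_notJJ M s N : chain_decomp I S M s N -> \tr N != 0 -> ~ JJ M.
Proof.
move=> D tN /decomp_JJ[s' D']; have [d d0 gap] := ideal_gap.
by rewrite (decomp_inj I_proj S_proj d0 gap D D') mxtrace0 eqxx in tN.
Qed.

Lemma flag1 f : S f -> IIflags PP I [:: f].
Proof.
move=> [Pf nIf]; split=> //; first by split=> // g; rewrite inE => /eqP->.
by move=> [_ /(_ f)]; rewrite mem_head => /(_ isT).
Qed.

Lemma sub_bigcup_Bk M : (\bigcup_(f in S) Bk v br A f) M ->
  [/\ Y M, chain_decomp I S M 0 M & \tr M = 1].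
Proof.
move=> [f Sf BM]; have [f1 pM tM Mf] := Bk_pos BM.
have D := decomp_single Sf pM (Mf (S_proj Sf)).
split=> //; split; last by apply: (decomp_notJJ D); rewrite tM oner_eq0.
by exists [:: f]; [exact: flag1|].
Qed.

Lemma IIflags_head f l : IIflags PP I (f :: l) -> S f.
Proof.
move=> [flag nflag Il]; have [_ Pf dec] := flag.
split; first by apply: Pf; rewrite mem_head.
by move=> If; apply: nflag; split=> // g; rewrite inE => /predU1P[->//|/Il].
Qed.

(** For a flag with several members, [M = (1 - u) P + u Q] with [u < 1], and [a = 1 - u]. Moving
    towards [P] stays in the same butterfly and shrinks the coefficient of [Q] to [(1 - t) u], so
    the upper part keeps positive trace and [JJ] is avoided. *)
Lemma Y_ray M : Y M -> exists f P (a s : R),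
  [/\ S f, Bk v br A f P, 0 < a & chain_decomp I S M s (a *: P)] /\
  forall t, 0 <= t <= 1 -> Y ((1 - t) *: M + t *: P).
Proof.
move=> YM; have [[s IIs BM] nJM] := YM.
case: s IIs BM => [[[]]//|f l] IIs BM; have Sf := IIflags_head IIs.
case: l IIs BM => [IIs BM|g l IIs].
  have /sub_bigcup_Bk[_ D _] : (\bigcup_(f in S) Bk v br A f) M by exists f.
  exists f, M, 1, 0; split; first by rewrite scale1r.
  by move=> t _; rewrite -scalerDl subrK scale1r.
have [flag _ Il] := IIs.
rewrite /butterfly; case: eqP => [f1 BM|f1].
  by case: nJM; exists [:: f, g & l] => //=; [split=> //; rewrite -f1 mem_head|rewrite f1 eqxx].
move=> [P [Q [u [BP hQ u01 ME]]]]; have /andP[u0 u1] := u01.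
have [_ pP tP Pf] := Bk_pos BP; have {}Pf := Pf (S_proj Sf).
have decomp t : 0 <= t <= 1 ->
    exists s, chain_decomp I S ((1 - t) *: P + t *: Q) s ((1 - t) *: P).
  move=> /andP[t0 t1]; apply: decomp_cone (flag) Sf Il _ _ hQ t0.
    by apply: psdZ; rewrite // subr_ge0.
  by rewrite -scalemxAl Pf scaler0.
(* If [u = 1], then [M] is in the hull of the tail, and prefixing the tail with [1%:M] gives a flag
   that puts [M] in [JJ]. *)
have u_lt1 : u < 1.
  rewrite lt_neqAle u1 andbT; apply/eqP => uE; apply: nJM.
  have flag1g : is_flag_in PP [:: 1%:M, g & l].
    have [_ Pfl dec] := flag; split=> // [h|[|i]].
    - by rewrite inE => /predU1P[->//|hl]; apply: Pfl; rewrite inE hl orbT.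
    - move=> _ /=; split=> [x _|g1]; first by rewrite /inspace mulmx1.
      by apply: nI1; rewrite -g1; apply: Il; rewrite mem_head.
    - exact: (dec i.+1).
  exists [:: 1%:M, g & l] => /=.
    split; last by rewrite mem_head.
    by split=> // -[_ h _]; apply/nI1/h; rewrite mem_head.
  by rewrite eqxx ME uE subrr scale0r add0r scale1r.
have [s D] := decomp u u01.
exists f, P, (1 - u), s; rewrite -ME in D; split=> [|t /andP[t0 t1]].
  by split=> //; rewrite subr_gt0.
have -> : (1 - t) *: M + t *: P =
    (1 - (1 - t) * u) *: P + ((1 - t) * u) *: Q.
  by rewrite ME; apply/matrixP => i j; rewrite !mxE; ring.
have tu : 0 <= (1 - t) * u < 1 by apply/andP; split; nra.
have /andP[tu0 tu1] := tu.
have tu01 : 0 <= (1 - t) * u <= 1 by rewrite tu0 ltW.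
split.
  exists [:: f, g & l] => //=; case: eqP => // _.
  by exists P, Q, ((1 - t) * u).
have [s' D'] := decomp _ tu01; apply: decomp_notJJ D' _.
by rewrite mxtraceZ tP mulr1 subr_eq0 gt_eqF.
Qed.

(** A choice with default 0; it is determined wherever a decomposition exists, since [N] is
    unique. *)
Definition upper_part M : 'M[R]_n :=
  xget 0 [set N | exists s, chain_decomp I S M s N].

Definition retraction (z : 'M[R]_n * R) : 'M[R]_n :=
  (1 - z.2) *: z.1 + z.2 *: ((\tr (upper_part z.1))^-1 *: upper_part z.1).

Lemma upper_partE M s N : chain_decomp I S M s N -> upper_part M = N.
Proof.
move=> D; have [d d0 gap] := ideal_gap.
have [s' D'] : exists s', chain_decomp I S M s' (upper_part M).
  by apply: (xgetPex 0 (P := [set N | exists s, chain_decomp I S M s N])); exists N, s.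
exact: (decomp_inj I_proj S_proj d0 gap D' D).
Qed.

Lemma retractionE M s a P t : chain_decomp I S M s (a *: P) -> 0 < a ->
  \tr P = 1 -> retraction (M, t) = (1 - t) *: M + t *: P.
Proof.
move=> D a0 tP; rewrite /retraction/= (upper_partE D) mxtraceZ tP mulr1.
by rewrite [a^-1 *: _]scalerA mulVf ?scale1r ?gt_eqF.
Qed.

Lemma upper_part_tr_gt0 M : Y M -> 0 < \tr (upper_part M).
Proof.
move=> /Y_ray[f [P [a [s [[Sf BP a0 D] _]]]]]; have [_ _ tP _] := Bk_pos BP.
by rewrite (upper_partE D) mxtraceZ tP mulr1.
Qed.

Lemma cvg_upper_part M i j : Y M ->
  upper_part M' i j @[M' --> within Y (nbhs M)] --> upper_part M i j.
Proof.
have [d d0 gap] := ideal_gap.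
pose K := 2 + 2 * n%:R * (n.+1%:R / d ^+ 2).
apply: (@frob_lipschitz_cvg _ _ _ _ K).
  by rewrite ltr_wpDr// mulr_ge0 ?divr_ge0 ?mulr_ge0 ?exprn_ge0// ltW.
move=> M1 M2 /Y_ray[f [P [a [s [[_ _ _ D] _]]]]].
move=> /Y_ray[f' [P' [a' [s' [[_ _ _ D'] _]]]]].
rewrite (upper_partE D) (upper_partE D').
exact: (decomp_pos_dist I_proj S_proj d0 gap D D').
Qed.

Lemma continuous_retraction : {within Y `*` `[0, 1], continuous retraction}.
Proof.
apply/subspace_continuousP => -[M t] [/= YM _].
set F := within _ _.
have FF : Filter F by exact: within_filter.
(* Continuity of [upper_part] is known only relative to [Y], so the first coordinate must converge
   within [Y]. *)
have F_fst : fst @ F --> within Y (nbhs M).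
  move=> U; rewrite /within/= => YU.
  have cvg_M : fst @ nbhs (M, t) --> M by exact: cvg_fst.
  have : nbhs (M, t) [set z | Y z.1 -> U z.1] := cvg_M _ YU.
  by apply: filterS => z YzU [/YzU].
have F_coef i j : (fun z : 'M[R]_n * R => z.1 i j) @ F --> M i j.
  apply: (@cvg_comp _ _ _ fst (fun M : 'M[R]_n => M i j) _ (nbhs M)).
    by apply: cvg_trans F_fst _; exact: cvg_within.
  exact: coord_continuous.
have F_snd : (fun z : 'M[R]_n * R => z.2) @ F --> t.
  by apply: (cvg_trans (cvg_app snd (cvg_within _)) _); exact: cvg_snd.
have F_up i j : (fun z : 'M[R]_n * R => upper_part z.1 i j) @ F --> upper_part M i j.
  apply: (@cvg_comp _ _ _ fst (fun M => upper_part M i j) F) F_fst _.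
  exact: cvg_upper_part.
have F_tr : (fun z : 'M[R]_n * R => \tr (upper_part z.1)) @ F --> \tr (upper_part M).
  by apply: cvg_sumr => i; exact: F_up.
apply: cvg_mx_coef => i j; rewrite /retraction/=.
rewrite !mxE; under eq_fun do rewrite !mxE.
apply: cvgD; apply: cvgM => //; first by apply: cvgB => //; exact: cvg_cst.
apply: cvgM => //; apply: cvgV => //.
by rewrite gt_eqF// upper_part_tr_gt0.
Qed.

Lemma butterfly_retract :
  strong_deformation_retract Y (\bigcup_(f in S) Bk v br A f).
Proof.
(* A point of [B[f]] is its own upper part and has trace 1, so [a = 1] and [P = M]. *)
have fixed M t : (\bigcup_(f in S) Bk v br A f) M -> retraction (M, t) = M.
  move=> /sub_bigcup_Bk[_ D tM]; rewrite -[M in X in chain_decomp _ _ _ _ X]scale1r in D.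
  by rewrite (retractionE _ D)// -scalerDl subrK scale1r.
split=> [M /sub_bigcup_Bk[]//|]; exists retraction; split.
- exact: continuous_retraction.
- move=> M t /Y_ray[f [P [a [s [[Sf BP a0 D] YP]]]]] t01.
  by have [_ _ tP _] := Bk_pos BP; rewrite (retractionE _ D)//; exact: YP.
- by move=> M YM; rewrite /retraction/= subr0 scale1r scale0r addr0.
- move=> M /Y_ray[f [P [a [s [[Sf BP a0 D] YP]]]]].
  have [_ _ tP _] := Bk_pos BP; rewrite (retractionE _ D)// subrr scale0r add0r.
  by rewrite scale1r; exists f.
- by move=> M t ? _; exact: fixed.
Qed.

End Butterflies.

Theorem theorem6p1 (R : realType) (n : nat)
    (br : 'rV[R]_n -> 'rV[R]_n -> 'rV[R]_n) (hp : 'M[R]_n) (A : set 'M[R]_n)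
    (I : set 'M[R]_n) (v : version) :
  lie_bracket br ->
  subalg br hp -> hp <> 1%:M ->
  compact_aut_group br hp A ->
  admissible (Pset br hp A) I ->
  strong_deformation_retract
    (Bflags v br A (IIflags (Pset br hp A) I) `\` Bflags v br A (JJflags (Pset br hp A) I))
    (\bigcup_(f in Pset br hp A `\` I) Bk v br A f).
Proof.
(* Since [hp <> 1%:M], the whole algebra [1%:M] is a member of [Pset]. *)
move=> _ _ hp1 _ admI; apply: butterfly_retract => //.
have in1 x : inspace 1%:M x by rewrite /inspace mulmx1.
by split; [split=> //; exact/is_projP/orthoproj1|split=> //; split].
Qed.
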